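(* Let $R$ be an associative ring with identity of finite left global dimension, and let $1\neq x\in Z(R)$ be a regular central element. Let $S:=R/(x)$, and let $N$ be a left $S$-module of type $\mathrm{FP}_\infty$ over $S$ with $\operatorname{pd}_R(N)=n<\infty$. Then $N$ has an $S$-projective resolution that is $2$-periodic in degrees $\ge n-1$.
   Context: All modules are left modules. $Z(R)$ is the center of $R$; a regular element is a non-zero-divisor. $N$ is regarded as an $R$-module via the quotient map $R\to S$, and $\operatorname{pd}_R$ denotes projective dimension over $R$. A module is of type $\mathrm{FP}_\infty$ over a ring if it has a projective resolution over that ring by finitely generated projective modules (of possibly infinite length). A resolution $(M_j,\partial_j:M_j\to M_{j-1})_{j\ge 0}$ is $2$-periodic in degrees $\ge m$ if $M_{j+2}=M_j$ for all $j\ge m$ and $\partial_{j+2}=\partial_j$ for all $j\ge m+1$. *)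

(* Defs.v *)
From HB Require Import structures.
From mathcomp Require Import all_boot all_algebra generic_quotient ring_quotient.
From mathcomp Require Import boolp.

Set Implicit Arguments.
Unset Strict Implicit.
Unset Printing Implicit Defensive.

Import GRing.Theory.
Local Open Scope ring_scope.
Local Open Scope quotient_scope.

(* Rings may be trivial (pzRingType): R / (x) is the zero ring when x is a
   unit.  A left R-module is an lmodType R. *)

Section QuotientRing.
Variables (R : pzRingType) (x : R).

(* The two-sided ideal (x): finite sums of elements a * x * b. *)
Definition ideal_gen : {pred R} := fun y =>
  `[< exists s : seq (R * R), y = \sum_(p <- s) p.1 * x * p.2 >].

Lemma ideal_gen_zmod_closed : zmod_closed ideal_gen.
Proof.
split=> [|u v]; first by apply/asboolP; exists [::]; rewrite big_nil.
move=> /asboolP[s ->] /asboolP[t ->]; apply/asboolP.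
exists (s ++ [seq (- p.1, p.2) | p <- t]).
rewrite big_cat big_map -sumrN; congr (_ + _).
by apply: eq_bigr => p _; rewrite /= !mulNr.
Qed.

HB.instance Definition _ :=
  GRing.isZmodClosed.Build R ideal_gen ideal_gen_zmod_closed.

Lemma ideal_genMl a y : y \in ideal_gen -> a * y \in ideal_gen.
Proof.
move=> /asboolP[s ->]; apply/asboolP; exists [seq (a * p.1, p.2) | p <- s].
by rewrite big_map mulr_sumr; apply: eq_bigr => p _; rewrite /= !mulrA.
Qed.

Lemma ideal_genMr a y : y \in ideal_gen -> y * a \in ideal_gen.
Proof.
move=> /asboolP[s ->]; apply/asboolP; exists [seq (p.1, p.2 * a) | p <- s].
by rewrite big_map mulr_suml; apply: eq_bigr => p _; rewrite /= !mulrA.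
Qed.

Definition ring_quot : Type := Quotient.quot ideal_gen.

HB.instance Definition _ := GRing.Zmodule.on ring_quot.

Definition ring_pi (y : R) : ring_quot := \pi_(Quotient.quot ideal_gen) y.

Lemma ring_pi_eq y z : ring_pi y = ring_pi z <-> y - z \in ideal_gen.
Proof. by rewrite Quotient.idealrBE; split=> [/eqP|/eqP]. Qed.

Lemma ring_pi_surj (u : ring_quot) : exists y, ring_pi y = u.
Proof. by exists (repr (u : Quotient.quot ideal_gen)); rewrite /ring_pi reprK. Qed.

Definition ring_quot_mul (u v : ring_quot) : ring_quot :=
  ring_pi (repr (u : Quotient.quot ideal_gen) * repr (v : Quotient.quot ideal_gen)).

Lemma ring_piM y z : ring_pi (y * z) = ring_quot_mul (ring_pi y) (ring_pi z).
Proof.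
apply/ring_pi_eq; set y' := repr _; set z' := repr _.
have Iy : y - y' \in ideal_gen by apply/ring_pi_eq; rewrite /ring_pi reprK.
have Iz : z - z' \in ideal_gen by apply/ring_pi_eq; rewrite /ring_pi reprK.
have -> : y * z - y' * z' = (y - y') * z + y' * (z - z').
  by rewrite mulrBl mulrBr addrA subrK.
exact: rpredD (ideal_genMr _ Iy) (ideal_genMl _ Iz).
Qed.

Lemma ring_piD y z : ring_pi (y + z) = ring_pi y + ring_pi z.
Proof. by rewrite /ring_pi raddfD. Qed.

Lemma ring_quot_mulA : associative ring_quot_mul.
Proof.
move=> u v w; have [a <-] := ring_pi_surj u; have [b <-] := ring_pi_surj v.
by have [c <-] := ring_pi_surj w; rewrite -!ring_piM mulrA.
Qed.

Lemma ring_quot_mul1r : left_id (ring_pi 1) ring_quot_mul.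
Proof. by move=> u; have [a <-] := ring_pi_surj u; rewrite -ring_piM mul1r. Qed.

Lemma ring_quot_mulr1 : right_id (ring_pi 1) ring_quot_mul.
Proof. by move=> u; have [a <-] := ring_pi_surj u; rewrite -ring_piM mulr1. Qed.

Lemma ring_quot_mulDl : left_distributive ring_quot_mul +%R.
Proof.
move=> u v w; have [a <-] := ring_pi_surj u; have [b <-] := ring_pi_surj v.
by have [c <-] := ring_pi_surj w; rewrite -!(ring_piM, ring_piD) mulrDl.
Qed.

Lemma ring_quot_mulDr : right_distributive ring_quot_mul +%R.
Proof.
move=> u v w; have [a <-] := ring_pi_surj u; have [b <-] := ring_pi_surj v.
by have [c <-] := ring_pi_surj w; rewrite -!(ring_piM, ring_piD) mulrDr.
Qed.

HB.instance Definition _ := GRing.Zmodule_isPzRing.Build ring_quot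
  ring_quot_mulA ring_quot_mul1r ring_quot_mulr1 ring_quot_mulDl ring_quot_mulDr.

Lemma ring_pi_zmod_morphism : zmod_morphism ring_pi.
Proof. by move=> y z; rewrite /ring_pi raddfB. Qed.

HB.instance Definition _ :=
  GRing.isZmodMorphism.Build R ring_quot ring_pi ring_pi_zmod_morphism.

Lemma ring_pi_monoid_morphism : monoid_morphism ring_pi.
Proof. by split=> // y z; rewrite ring_piM. Qed.

HB.instance Definition _ :=
  GRing.isMonoidMorphism.Build R ring_quot ring_pi ring_pi_monoid_morphism.

End QuotientRing.

Definition restr_scalars (R S : pzRingType) (f : {rmorphism R -> S})
  (N : lmodType S) : Type := N.

Section RestrictionOfScalars.
Variables (R S : pzRingType) (f : {rmorphism R -> S}) (N : lmodType S).

HB.instance Definition _ := GRing.Zmodule.on (restr_scalars f N).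

Definition restr_scale (a : R) (v : restr_scalars f N) : restr_scalars f N :=
  f a *: (v : N).

Lemma restr_scaleA a b v :
  restr_scale a (restr_scale b v) = restr_scale (a * b) v.
Proof. by rewrite /restr_scale scalerA rmorphM. Qed.

Lemma restr_scale1 : left_id 1 restr_scale.
Proof. by move=> v; rewrite /restr_scale rmorph1 scale1r. Qed.

Lemma restr_scaleDr : right_distributive restr_scale +%R.
Proof. by move=> a u v; rewrite /restr_scale -scalerDr. Qed.

Lemma restr_scaleDl v : {morph restr_scale^~ v : a b / a + b}.
Proof. by move=> a b; rewrite /restr_scale rmorphD scalerDl. Qed.

HB.instance Definition _ := GRing.Zmodule_isLmodule.Build R (restr_scalars f N)
  restr_scaleA restr_scale1 restr_scaleDr restr_scaleDl.

End RestrictionOfScalars.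

Definition projective (R : pzRingType) (P : lmodType R) : Prop :=
  forall (A B : lmodType R) (g : {linear A -> B}) (h : {linear P -> B}),
    (forall b, exists a, g a = b) ->
    exists k : {linear P -> A}, forall p, g (k p) = h p.

Definition finitely_generated (R : pzRingType) (M : lmodType R) : Prop :=
  exists (k : nat) (e : 'I_k -> M),
    forall v : M, exists c : 'I_k -> R, v = \sum_(i < k) c i *: e i.

(* Left resolutions  ... -> M_2 -> M_1 -> M_0 -> N -> 0.  The differential
   M_{j+1} -> M_j, usually written d_{j+1}, is [res_d j] here. *)
Record resolution (R : pzRingType) (N : lmodType R) := Resolution {
  res_mod :> nat -> lmodType R;
  res_d : forall j, {linear res_mod j.+1 -> res_mod j};
  res_aug : {linear res_mod 0%N -> N};
  res_aug_surj : forall v : N, exists u, res_aug u = v;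
  res_exact0 : forall u : res_mod 0%N,
    res_aug u = 0 <-> exists w, res_d 0%N w = u;
  res_exactS : forall j (u : res_mod j.+1),
    res_d j u = 0 <-> exists w, res_d j.+1 w = u
}.

Definition projective_resolution (R : pzRingType) (N : lmodType R)
    (M : resolution N) : Prop := forall j, projective (M j).

Definition FP_infty (R : pzRingType) (N : lmodType R) : Prop :=
  exists M : resolution N,
    projective_resolution M /\ forall j, finitely_generated (M j).

Definition proj_dim_le (R : pzRingType) (N : lmodType R) (n : nat) : Prop :=
  exists M : resolution N, projective_resolution M /\
    forall j, (n < j)%N -> forall v : M j, v = 0.

(* [proj_dim N n] means pd_R(N) = n; in particular it is finite.  The zero
   module has projective dimension 0 with this convention. *)
Definition proj_dim (R : pzRingType) (N : lmodType R) (n : nat) : Prop :=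
  proj_dim_le N n /\ forall m, proj_dim_le N m -> (n <= m)%N.

Definition finite_left_global_dim (R : pzRingType) : Prop :=
  exists d : nat, forall N : lmodType R, proj_dim_le N d.

Definition lmod_cast (R : pzRingType) (A B : lmodType R) (e : A = B) :
    A -> B :=
  match e in _ = B' return A -> B' with erefl => id end.

(* Equality of modules is literal equality, and equality of the differentials
   d_{j+3} = d_{j+1} for j >= m (that is, res_d j.+2 = res_d j) is read along
   the identifications M_{j+3} = M_{j+1} and M_{j+2} = M_j. *)
Definition two_periodic_from (R : pzRingType) (N : lmodType R)
    (M : resolution N) (m : nat) : Prop :=
  exists e : forall j, (m <= j)%N -> M j.+2 = M j,
    forall j (mj : (m <= j)%N) (v : M j.+3),
      lmod_cast (e j mj) (res_d M j.+2 v)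
      = res_d M j (lmod_cast (e j.+1 (leqW mj)) v).

(* Main.v *)
(* Take projective R-modules ... -> M_2 -> M_1 -> M_0 resolving N.  As x kills
   N, multiplication by x on M_0 factors as d \o s with s : M_0 -> M_1.
   If M_j = 0 for j > 1, then d and s form a matrix factorization of x, and
   reducing modulo x gives the 2-periodic S-resolution
     ... -> M_1/x -> M_0/x -> M_1/x -> M_0/x -> N.
   In general, the kernel K of M_0/x -> N is resolved over R by
     ... -> M_4 -> M_3 -> M_2 * M_0 -> M_1 -> K,  with (a, b) |-> d a + s b,
   which is one step shorter as long as it has length at least 1; by induction
   the (n-1)-st syzygy of N over S has an R-projective resolution of length
   at most 1. *)
Require Import Defs.
From HB Require Import structures.
From mathcomp Require Import all_boot all_algebra generic_quotient ring_quotient.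
From mathcomp Require Import boolp functions classical_sets fsbigop.

Set Implicit Arguments.
Unset Strict Implicit.
Unset Printing Implicit Defensive.

Import GRing.Theory.
Local Open Scope ring_scope.

(** * Submodules and kernels as modules *)

Section Submodule.
Variables (R : pzRingType) (V : lmodType R) (P : submodClosed V).

Record submod := Submod { submod_val : V; submod_valP : submod_val \in P }.

HB.instance Definition _ := [isSub for submod_val].
HB.instance Definition _ := [Choice of submod by <:].
HB.instance Definition _ := [SubChoice_isSubLmodule of submod by <:].

End Submodule.

Definition mk_linear (R : pzRingType) (A B : lmodType R) (f : A -> B)
    (lf : linear f) : {linear A -> B} :=
  HB.pack f (GRing.isLinear.Build R A B *:%R f lf).

Section Kernel.
Variables (R : pzRingType) (A B : lmodType R) (g : {linear A -> B}).

Definition ker_pred : {pred A} := fun v => g v == 0.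

Lemma ker_submod_closed : submod_closed ker_pred.
Proof.
split=> [|a u v]; rewrite /in_mem /= /ker_pred ?linear0 //.
by move=> /eqP gu /eqP gv; rewrite linearP gu gv scaler0 addr0.
Qed.

HB.instance Definition _ :=
  GRing.isSubmodClosed.Build R A ker_pred ker_submod_closed.

Definition kernel : lmodType R := submod ker_pred.

Lemma kernelP (u : kernel) : g (val u) = 0.
Proof. exact/eqP/(valP u). Qed.

Definition to_kernel v (gv : g v = 0) : kernel :=
  Submod (introT eqP gv : v \in ker_pred).

End Kernel.

(** * Free modules and their evaluation maps *)

Section FreeModule.
Variables (R : pzRingType) (P : lmodType R).

Definition fin_supp : {pred (P -> R^o)} := fun f =>
  `[< exists s : seq P, forall p, p \notin s -> f p = 0 >].

Lemma fin_supp_submod_closed : submod_closed fin_supp.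
Proof.
split=> [|a f g /asboolP[s fs] /asboolP[t gt]]; apply/asboolP.
  by exists [::].
exists (s ++ t) => p; rewrite mem_cat negb_or => /andP[/fs fp /gt gp].
by rewrite /GRing.add /= /GRing.scale /= fp gp scaler0 addr0.
Qed.

HB.instance Definition _ :=
  GRing.isSubmodClosed.Build R (P -> R^o) fin_supp fin_supp_submod_closed.

Definition free_lmod : lmodType R := submod fin_supp.

Definition free_coef (f : free_lmod) : P -> R := val f.

Lemma free_coefD a f g p :
  free_coef (a *: f + g) p = a * free_coef f p + free_coef g p.
Proof. by []. Qed.

(** The sum runs over all of [P] and collects only the nonzero terms, so the definition involves no
    choice of a support. *)
Definition free_eval (f : free_lmod) : P :=
  \sum_(p \in [set: P]%classic) free_coef f p *: p.

Lemma free_evalE (f : free_lmod) (s : seq P) :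
  (forall p, p \notin s -> free_coef f p = 0) ->
  free_eval f = \sum_(p <- undup s) free_coef f p *: p.
Proof.
move=> fs; rewrite [RHS](@bigfs _ _ _ _ _ xpredT) ?undup_uniq //.
  rewrite /free_eval (_ : [set: P]%classic = [set` xpredT]%classic) //.
  exact/seteqP.
by move=> p _; rewrite mem_undup => /fs ->; rewrite scale0r.
Qed.

Lemma free_eval_linear : linear free_eval.
Proof.
move=> a f g; have [/asboolP[s fs] /asboolP[t gt]] := (valP f, valP g).
have fst p : p \notin s ++ t -> free_coef f p = 0.
  by rewrite mem_cat negb_or => /andP[/fs].
have gst p : p \notin s ++ t -> free_coef g p = 0.
  by rewrite mem_cat negb_or => /andP[_ /gt].
rewrite (free_evalE fst) (free_evalE gst) (free_evalE (s := s ++ t)).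
  rewrite scaler_sumr -big_split; apply: eq_bigr => p _.
  by rewrite free_coefD scalerDl scalerA.
by move=> p pst; rewrite free_coefD fst // gst // mulr0 addr0.
Qed.

Lemma free_eval_surj v : exists f, free_eval f = v.
Proof.
pose d : P -> R^o := fun p => (p == v)%:R.
have dv p : p \notin [:: v] -> d p = 0.
  by rewrite inE /d => /negbTE ->.
have fd : d \in fin_supp by apply/asboolP; exists [:: v].
exists (Submod fd); rewrite (@free_evalE (Submod fd) _ dv) big_seq1.
by rewrite /free_coef /= /d eqxx scale1r.
Qed.

End FreeModule.

(** * Projective modules over an arbitrary ring *)

Section Projective.
Variables (R : pzRingType).

(** As [d] need not be onto, projectivity is applied to the pullback of [h] and [d]: its projection
    to [P] is onto, hence has a section, whose second coordinate is the lift. *)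
Lemma projective_lift (P A B : lmodType R) (d : {linear A -> B})
    (h : {linear P -> B}) :
  projective P -> (forall p, exists a, d a = h p) ->
  exists k : {linear P -> A}, forall p, d (k p) = h p.
Proof.
move=> projP hd.
have lf : linear (fun z : P * A => h z.1 - d z.2).
  by move=> a u v; rewrite /= !linearP /= scalerDr addrACA.
pose f := mk_linear lf.
have lpr1 : linear (fun z : kernel f => (val z).1) by [].
have lpr2 : linear (fun z : kernel f => (val z).2) by [].
have [p|s sK] := projP _ _ (mk_linear lpr1) idfun.
  have [a da] := hd p.
  have fpa : f (p, a) = 0 by rewrite /= da subrr.
  by exists (to_kernel fpa).
exists (mk_linear lpr2 \o s) => p /=.
have sp : (submod_val (s p)).1 = p := sK p.
by have /eqP := kernelP (s p); rewrite /= sp subr_eq0 => /eqP.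
Qed.

Lemma projective_prod (P Q : lmodType R) :
  projective P -> projective Q -> projective (P * Q)%type.
Proof.
move=> projP projQ A B g h gsurj.
have l1 : linear (fun p : P => h (p, 0)).
  by move=> a u v; rewrite -linearP; congr (h (_, _)); rewrite /= scaler0 addr0.
have l2 : linear (fun q : Q => h (0, q)).
  by move=> a u v; rewrite -linearP; congr (h (_, _)); rewrite /= scaler0 addr0.
have [k1 k1E] := projP _ _ g (mk_linear l1) gsurj.
have [k2 k2E] := projQ _ _ g (mk_linear l2) gsurj.
have lk : linear (fun z : P * Q => k1 z.1 + k2 z.2).
  by move=> a u v; rewrite /= !linearP scalerDr addrACA.
exists (mk_linear lk) => -[p q] /=.
by rewrite linearD k1E k2E /= -linearD; congr (h (_, _)); rewrite ?addr0 ?add0r.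
Qed.

(* P embeds in a free module, on which x acts injectively. *)
Lemma projective_lreg (P : lmodType R) (x : R) (v : P) :
  GRing.lreg x -> projective P -> x *: v = 0 -> v = 0.
Proof.
move=> xreg projP xv0.
have [k kE] := projP _ _ (mk_linear (@free_eval_linear R P)) idfun
  (@free_eval_surj R P).
have kx : x *: k v = 0 by rewrite -[RHS](linear0 k) -xv0 linearZ.
rewrite -[v]kE; suff -> : k v = 0 by rewrite linear0.
apply/val_inj/funext => p; apply: xreg; rewrite mulr0.
by have := congr1 (fun f : free_lmod P => free_coef f p) kx.
Qed.

End Projective.

(** * Reduction modulo a central element *)

Section Reduction.
Variables (R : pzRingType) (x : R) (cx : forall y, GRing.comm x y).

(** Centrality moves [x] to the front of every summand of [y]. *)
Lemma ideal_gen_scale (Q : lmodType R) (y : R) (v : Q) :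
  y \in ideal_gen x -> exists w, y *: v = x *: w.
Proof.
move=> /asboolP[s ->]; exists ((\sum_(p <- s) p.1 * p.2) *: v).
rewrite scalerA mulr_sumr; congr (_ *: v); apply: eq_bigr => p _.
by rewrite -(cx p.1) mulrA.
Qed.

Lemma mem_ideal_gen : x \in ideal_gen x.
Proof. by apply/asboolP; exists [:: (1, 1)]; rewrite big_seq1 mul1r mulr1. Qed.

Lemma ring_pi_gen : ring_pi x x = 0.
Proof.
rewrite -(raddf0 (@ring_pi R x)); apply/ring_pi_eq.
by rewrite subr0 mem_ideal_gen.
Qed.

Section Quotient.
Variable Q : lmodType R.

Definition multiples : {pred Q} := fun v => `[< exists w, v = x *: w >].

Lemma multiplesP (v : Q) : reflect (exists w, v = x *: w) (v \in multiples).
Proof. exact: asboolP. Qed.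

Lemma multiples_zmod_closed : zmod_closed multiples.
Proof.
split=> [|u v /multiplesP[u' ->] /multiplesP[v' ->]]; apply/multiplesP.
  by exists 0; rewrite scaler0.
by exists (u' - v'); rewrite scalerBr.
Qed.

HB.instance Definition _ :=
  GRing.isZmodClosed.Build Q multiples multiples_zmod_closed.

(* Q / xQ is a module over R / (x) only because x is central, so the type
   carries the proof of centrality. *)
Definition red_type of (forall y, GRing.comm x y) : Type :=
  Quotient.quot multiples.

Local Notation redT := (red_type cx).

HB.instance Definition _ := GRing.Zmodule.on redT.

Definition red_pi (v : Q) : redT := (\pi_(Quotient.quot multiples) v)%qT.

Definition red_repr (u : redT) : Q := repr (u : Quotient.quot multiples).

Lemma red_reprK u : red_pi (red_repr u) = u.
Proof. by rewrite /red_pi /red_repr reprK. Qed.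

Lemma red_pi_eq v w : red_pi v = red_pi w <-> exists u, v - w = x *: u.
Proof.
split=> [/eqP|h]; last apply/eqP.
  rewrite -[_ == _]/(_ == _ :> Quotient.quot _) -Quotient.idealrBE.
  by move/multiplesP.
rewrite -[_ == _]/(_ == _ :> Quotient.quot _) -Quotient.idealrBE.
exact/multiplesP.
Qed.

Lemma red_piD v w : red_pi (v + w) = red_pi v + red_pi w.
Proof. by rewrite /red_pi raddfD. Qed.

Definition red_scale (a : ring_quot x) (u : redT) : redT :=
  red_pi (repr (a : Quotient.quot (ideal_gen x)) *: red_repr u).

Lemma red_piZ a v : red_pi (a *: v) = red_scale (ring_pi x a) (red_pi v).
Proof.
apply/red_pi_eq; set a' := repr _; set v' := red_repr _.
have /ideal_gen_scale ia : a - a' \in ideal_gen x.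
  by apply/ring_pi_eq; rewrite /ring_pi reprK.
have [w vw] : exists w, v - v' = x *: w by apply/red_pi_eq; rewrite red_reprK.
have [u au] := ia _ v.
(* The witness comes from [a v - a' v' = (a - a') v + a' (v - v')], where [x] is moved past [a'] by
   centrality. *)
exists (u + a' *: w).
by rewrite scalerDr -au scalerBl scalerA cx -scalerA -vw scalerBr addrA subrK.
Qed.

Lemma red_scaleA a b u : red_scale a (red_scale b u) = red_scale (a * b) u.
Proof.
have [a' <-] := ring_pi_surj a; have [b' <-] := ring_pi_surj b.
by rewrite -[u]red_reprK -rmorphM -!red_piZ scalerA.
Qed.

Lemma red_scale1 : left_id 1 red_scale.
Proof.
by move=> u; rewrite -[u]red_reprK -(rmorph1 (@ring_pi R x)) -red_piZ scale1r.
Qed.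

Lemma red_scaleDr : right_distributive red_scale +%R.
Proof.
move=> a u v; have [a' <-] := ring_pi_surj a.
by rewrite -[u]red_reprK -[v]red_reprK -red_piD -!red_piZ scalerDr red_piD.
Qed.

Lemma red_scaleDl u : {morph red_scale^~ u : a b / a + b}.
Proof.
move=> a b; have [a' <-] := ring_pi_surj a; have [b' <-] := ring_pi_surj b.
by rewrite -[u]red_reprK -rmorphD -!red_piZ scalerDl red_piD.
Qed.

HB.instance Definition _ := GRing.Zmodule_isLmodule.Build (ring_quot x) redT
  red_scaleA red_scale1 red_scaleDr red_scaleDl.

Definition red : lmodType (ring_quot x) := redT.

Definition restr (N : lmodType (ring_quot x)) : lmodType R :=
  restr_scalars (@ring_pi R x) N.

Lemma red_pi_linear : linear (red_pi : Q -> restr red).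
Proof. by move=> a u v; rewrite red_piD red_piZ. Qed.

Definition proj : {linear Q -> restr red} := mk_linear red_pi_linear.

Lemma proj_surj (u : red) : exists v, proj v = u.
Proof. by exists (red_repr u); apply: red_reprK. Qed.

Lemma proj_eq0 v : proj v = 0 <-> exists w, v = x *: w.
Proof.
rewrite -(linear0 proj); split=> [/red_pi_eq|[w vw]]; first by rewrite subr0.
by apply/red_pi_eq; exists w; rewrite subr0.
Qed.

Lemma restr_scale_gen (N : lmodType (ring_quot x)) (v : restr N) : x *: v = 0.
Proof. by rewrite -[LHS]/(ring_pi x x *: (v : N)) ring_pi_gen scale0r. Qed.

Section Lift.
Variables (N : lmodType (ring_quot x)) (f : {linear Q -> restr N}).

Definition red_lift_fun (u : red) : N := f (red_repr u).

(** The choice of representative is harmless: [x] acts as zero on [restr N], so [f] kills the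
    multiples of [x]. *)
Lemma red_lift_funE v : red_lift_fun (proj v) = f v.
Proof.
have [w vw] : exists w, red_repr (proj v) - v = x *: w.
  by apply/red_pi_eq; rewrite red_reprK.
apply/eqP; rewrite -subr_eq0 /red_lift_fun -[_ - _]/(f _ - f v : restr N).
by rewrite -linearB vw linearZ /= restr_scale_gen.
Qed.

Lemma red_lift_linear : linear red_lift_fun.
Proof.
move=> a u v; have [a' <-] := ring_pi_surj a.
have [u' <-] := proj_surj u; have [v' <-] := proj_surj v.
by rewrite -[_ + _]/(a' *: proj u' + proj v') -linearP !red_lift_funE linearP.
Qed.

Definition red_lift : {linear red -> N} := mk_linear red_lift_linear.

Lemma red_liftE v : red_lift (proj v) = f v.
Proof. exact: red_lift_funE. Qed.

End Lift.

End Quotient.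

Definition red_map (Q Q' : lmodType R) (f : {linear Q -> Q'}) :
  {linear red Q -> red Q'} := red_lift (proj Q' \o f).

Lemma red_mapE (Q Q' : lmodType R) (f : {linear Q -> Q'}) v :
  red_map f (proj _ v) = proj _ (f v).
Proof. exact: red_liftE. Qed.

End Reduction.

(** * Resolutions over [R] and over its quotient by [x] *)

Section Resolutions.
Variables (R : pzRingType) (x : R) (cx : forall y, GRing.comm x y).
Hypothesis x_lreg : GRing.lreg x.
Local Notation S := (ring_quot x).

(** Reduction is left adjoint to restriction of scalars: a lifting problem out of [red cx Q] becomes
    one out of [Q] over [R], and [red_lift] carries the solution back. *)
Lemma projective_red (Q : lmodType R) : projective Q -> projective (red cx Q).
Proof.
move=> projQ A B g h gsurj.
have lg : linear (g : restr A -> restr B).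
  by move=> a u v; rewrite -[_ + _]/(ring_pi x a *: (u : A) + v) linearP.
have lh : linear (fun v : Q => h (proj cx Q v) : restr B).
  by move=> a u v; rewrite linearP; apply: (linearP h).
have [k kE] := projQ _ _ (mk_linear lg) (mk_linear lh) gsurj.
exists (red_lift cx k) => p; have [v <-] := proj_surj p.
by rewrite red_liftE; apply: kE.
Qed.

(** * Splicing a resolution of a kernel onto a surjection *)

Section Splice.
Variables (T : pzRingType) (N P : lmodType T) (g : {linear P -> N}).
Hypothesis g_surj : forall v, exists u, g u = v.
Variable M : resolution (kernel g).

Definition splice_mod (j : nat) : lmodType T :=
  if j is j'.+1 then M j' else P.

Lemma splice_d0_linear : linear (fun u : M 0%N => val (res_aug M u)).
Proof. by move=> a u v; rewrite linearP. Qed.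

Definition splice_d (j : nat) : {linear splice_mod j.+1 -> splice_mod j} :=
  if j is j'.+1 return {linear splice_mod j.+1 -> splice_mod j}
  then res_d M j' else mk_linear splice_d0_linear.

Lemma splice_exact0 (u : splice_mod 0) :
  g u = 0 <-> exists w, splice_d 0 w = u.
Proof.
split=> [gu|[w <-]]; last exact: (kernelP (res_aug M w)).
have [w wu] := res_aug_surj M (to_kernel gu).
by exists w; rewrite /= wu.
Qed.

Lemma splice_exactS j (u : splice_mod j.+1) :
  splice_d j u = 0 <-> exists w, splice_d j.+1 w = u.
Proof.
case: j u => [|j] u; last exact: res_exactS.
rewrite -[exists _, _]/(exists w, res_d M 0 w = u) -res_exact0.
by split=> [/= u0|/= ->] //; apply: val_inj.
Qed.

Definition splice : resolution N :=
  Resolution g_surj splice_exact0 splice_exactS.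

Lemma splice_projective :
  projective P -> projective_resolution M -> projective_resolution splice.
Proof. by move=> projP projM [|j]; [apply: projP | apply: projM]. Qed.

Lemma splice_two_periodic m :
  two_periodic_from M m -> two_periodic_from splice m.+1.
Proof.
move=> [e eE].
exists (fun j => if j is j'.+1 return (m.+1 <= j)%N ->
                   splice_mod j.+2 = splice_mod j
                 then fun mj => e j' mj
                 (* Degree 0 lies below the bound [m.+1], so no equality of modules is required
                    there. *)
                 else fun mj => False_ind _ (notF mj)).
case=> // j mj v.
rewrite /= (bool_irrelevance (leqW mj) (leqW (mj : (m <= j)%N))).
exact: eE.
Qed.

End Splice.

(** * Resolutions that are 2-periodic from the start *)

Section Periodic.
Variables (T : pzRingType) (N P0 P1 : lmodType T).
Variables (d : {linear P1 -> P0}) (s : {linear P0 -> P1}).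
Variable g : {linear P0 -> N}.
Hypothesis g_surj : forall v, exists u, g u = v.
Hypothesis exact_g : forall u, g u = 0 <-> exists w, d w = u.
Hypothesis exact_d : forall u, d u = 0 <-> exists w, s w = u.
Hypothesis exact_s : forall u, s u = 0 <-> exists w, d w = u.

(** Recursion in steps of two makes degrees [j.+2] and [j] convertible, so the required equalities
    of modules are [erefl] and the casts vanish. *)
Fixpoint periodic_mod (j : nat) : lmodType T :=
  match j with 0 => P0 | 1 => P1 | j'.+2 => periodic_mod j' end.

Fixpoint periodic_d (j : nat) : {linear periodic_mod j.+1 -> periodic_mod j} :=
  match j return {linear periodic_mod j.+1 -> periodic_mod j} with
  | 0 => d | 1 => s | j'.+2 => periodic_d j' end.

Lemma periodic_exactS j (u : periodic_mod j.+1) :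
  periodic_d j u = 0 <-> exists w, periodic_d j.+1 w = u.
Proof.
(* Two consecutive degrees are treated together, because the recursion descends by two. *)
suff: (forall u, periodic_d j u = 0 <-> exists w, periodic_d j.+1 w = u) /\
      (forall u, periodic_d j.+1 u = 0 <-> exists w, periodic_d j.+2 w = u).
  by case.
by elim: j {u} => [|j [IH0 IH1]].
Qed.

Definition periodic : resolution N :=
  @Resolution T N periodic_mod periodic_d g g_surj exact_g periodic_exactS.

Lemma periodic_projective :
  projective P0 -> projective P1 -> projective_resolution periodic.
Proof.
move=> proj0 proj1 j.
suff: projective (periodic_mod j) /\ projective (periodic_mod j.+1) by case.
by elim: j => [|j []].
Qed.

Lemma periodic_two_periodic : two_periodic_from periodic 0.
Proof. by exists (fun j _ => erefl). Qed.

End Periodic.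

(** * From an [R]-resolution to the reduced augmentation over [S] *)

Section Step.
Variables (N : lmodType S) (M : resolution (restr N)).
Hypothesis projM : projective_resolution M.

Lemma res_dd j (u : M j.+2) : res_d M j (res_d M j.+1 u) = 0.
Proof. by apply/res_exactS; exists u. Qed.

Lemma scale_linear (Q : lmodType R) : linear (fun v : Q => x *: v).
Proof. by move=> a u v; rewrite scalerDr !scalerA cx. Qed.

(** The differential into [M 0] is not onto, but its image contains all multiples of [x], which is
    what [projective_lift] asks for. *)
Lemma scale_homotopy :
  exists s : {linear M 0%N -> M 1%N}, forall v, res_d M 0 (s v) = x *: v.
Proof.
pose mulx := mk_linear (scale_linear (Q := M 0%N)).
have [|s sE] := projective_lift (d := res_d M 0) (h := mulx) (@projM 0%N).
  move=> v; apply: (res_exact0 (x *: v)).1.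
  by rewrite linearZ /= restr_scale_gen.
by exists s.
Qed.

Definition red_aug : {linear red cx (M 0%N) -> N} := red_lift cx (res_aug M).

Lemma red_augE v : red_aug (proj cx _ v) = res_aug M v.
Proof. exact: red_liftE. Qed.

Lemma red_aug_eq0 v :
  red_aug (proj cx _ v) = 0 <-> exists w, res_d M 0 w = v.
Proof. by rewrite red_augE; have := res_exact0 v. Qed.

Lemma red_aug_surj v : exists u, red_aug u = v.
Proof.
have [u <-] := res_aug_surj M v.
by exists (proj cx _ u); rewrite red_augE.
Qed.

Section Homotopy.
Variable s : {linear M 0%N -> M 1%N}.
Hypothesis sE : forall v, res_d M 0 (s v) = x *: v.

Lemma scale_inj j (v : M j) : x *: v = 0 -> v = 0.
Proof. exact/projective_lreg. Qed.

Lemma scale_injB j (v w : M j) : x *: v = x *: w -> v = w.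
Proof.
move=> vw; apply/eqP; rewrite -subr_eq0; apply/eqP/scale_inj.
by rewrite scalerBr vw subrr.
Qed.

(** * Length at most one: matrix factorizations of [x] *)

Section ShortCase.
Hypothesis M_short : forall v : M 2%N, v = 0.

Lemma short_d_inj u : res_d M 0 u = 0 -> u = 0.
Proof. by move=> /res_exactS[w <-]; rewrite [w]M_short linear0. Qed.

Lemma short_d_injB u v : res_d M 0 u = res_d M 0 v -> u = v.
Proof.
move=> uv; apply/eqP; rewrite -subr_eq0; apply/eqP/short_d_inj.
by rewrite linearB uv /= subrr.
Qed.

Lemma short_exact_g u :
  red_aug u = 0 <-> exists w, red_map cx (res_d M 0) w = u.
Proof.
have [v <-] := proj_surj u; split=> [/red_aug_eq0[w <-]|].
  by exists (proj cx _ w); rewrite red_mapE.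
move=> [w]; have [{}w <-] := proj_surj w; rewrite red_mapE => wv.
by rewrite -wv; apply/red_aug_eq0; exists w.
Qed.

(** Writing [d] for [res_d M 0]: if [d v = x w], then [d v = d (s w)], and [d] is injective because
    [M 2] vanishes. *)
Lemma short_exact_d u :
  red_map cx (res_d M 0) u = 0 <-> exists w, red_map cx s w = u.
Proof.
have [v <-] := proj_surj u; rewrite red_mapE; split=> [/proj_eq0[w]|].
  by rewrite -sE => /short_d_injB ->; exists (proj cx _ w); rewrite red_mapE.
move=> [w]; have [{}w <-] := proj_surj w; rewrite red_mapE => wv.
by rewrite -red_mapE -wv red_mapE; apply/proj_eq0; exists w; rewrite sE.
Qed.

(** If [s v = x w], then [x v = d (s v) = x (d w)], and [x] cancels on the projective module [M 0].
    Conversely [s (d w) = x w], since both sides have the same image under the injective [d]. *)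
Lemma short_exact_s u :
  red_map cx s u = 0 <-> exists w, red_map cx (res_d M 0) w = u.
Proof.
have [v <-] := proj_surj u; rewrite red_mapE; split=> [/proj_eq0[w sv]|].
  have vw : v = res_d M 0 w by apply: scale_injB; rewrite -sE sv linearZ.
  by rewrite vw; exists (proj cx _ w); rewrite red_mapE.
move=> [w]; have [{}w <-] := proj_surj w; rewrite red_mapE => wv.
rewrite -red_mapE -wv red_mapE; apply/proj_eq0; exists w.
by apply: short_d_injB; rewrite sE linearZ.
Qed.

Lemma short_two_periodic :
  exists M' : resolution N, projective_resolution M' /\ two_periodic_from M' 0.
Proof.
exists (periodic red_aug_surj short_exact_g short_exact_d short_exact_s).
split; last exact: periodic_two_periodic.
by apply: periodic_projective; apply: projective_red.
Qed.

End ShortCase.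

(** * An [R]-resolution of the first syzygy over [S] *)

Lemma aug_proj_d (q : M 1%N) : red_aug (proj cx _ (res_d M 0 q)) = 0.
Proof. by apply/red_aug_eq0; exists q. Qed.

(** This is a mapping cone. The kernel of [red_aug] is the image of [res_d M 0] modulo [x M_0]; the
    modules [M_j] with [j >= 1] resolve that image, and [s] lifts multiplication by [x] from [M_0]
    into it. *)
Definition syz_mod (j : nat) : lmodType R :=
  match j with
  | 0 => M 1%N
  | 1 => (M 2%N * M 0%N)%type
  | j'.+2 => M j'.+3
  end.

Lemma syz_aug_linear :
  linear (fun q => to_kernel (aug_proj_d q) : restr (kernel red_aug)).
Proof.
move=> a u v; apply: val_inj; pose f := proj cx (M 0%N) \o res_d M 0.
exact: (linearP f a u v).
Qed.

Lemma syz_d0_linear :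
  linear (fun z : M 2%N * M 0%N => res_d M 1 z.1 + s z.2).
Proof. by move=> a u v; rewrite /= !linearP scalerDr addrACA. Qed.

Lemma syz_d1_linear : linear (fun w : M 3%N => (res_d M 2 w, 0 : M 0%N)).
Proof.
by move=> a u v; rewrite linearP; congr (_, _); rewrite /= scaler0 addr0.
Qed.

Definition syz_d (j : nat) : {linear syz_mod j.+1 -> syz_mod j} :=
  match j return {linear syz_mod j.+1 -> syz_mod j} with
  | 0 => mk_linear syz_d0_linear
  | 1 => mk_linear syz_d1_linear
  | j'.+2 => res_d M j'.+3
  end.

Lemma syz_aug_surj (v : restr (kernel red_aug)) :
  exists u, mk_linear syz_aug_linear u = v.
Proof.
have [u uv] := proj_surj (val (v : kernel red_aug)).
have /red_aug_eq0[q qu] : red_aug (proj cx _ u) = 0 by rewrite uv kernelP.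
by exists q; apply: val_inj; rewrite /= qu.
Qed.

Lemma syz_exact0 (q : M 1%N) :
  mk_linear syz_aug_linear q = 0 <-> exists w, syz_d 0 w = q.
Proof.
split=> [/(congr1 (fun u : kernel red_aug => val u)) /=|[[a b] <-]].
  (* Here [d q = x b = d (s b)], so [q - s b] is a cycle and hence a boundary [d a]. *)
  move=> /proj_eq0[b qb].
  have /res_exactS[a aE] : res_d M 0 (q - s b) = 0.
    by rewrite linearB /= sE qb subrr.
  by exists (a, b); rewrite /= aE subrK.
apply: val_inj; rewrite /= linearD /= res_dd add0r sE.
by apply: (proj_eq0 cx (x *: b)).2; exists b.
Qed.

Lemma syz_exactS j (u : syz_mod j.+1) :
  syz_d j u = 0 <-> exists w, syz_d j.+1 w = u.
Proof.
case: j u => [|[|j]] u; last exact: res_exactS.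
  case: u => a b /=; split=> [ab|[w [<- <-]]]; last first.
    by rewrite res_dd linear0 addr0.
  (* Applying [d] to [d a + s b = 0] leaves [x b = 0], and [x] acts injectively on [M 0]. *)
  have b0 : b = 0.
    apply: scale_inj; rewrite -sE -[s b](addKr (res_d M 1 a)) ab addr0.
    by rewrite linearN /= res_dd oppr0.
  move: ab; rewrite b0 linear0 addr0 => /res_exactS[w <-].
  by exists w.
(* The second component of the map out of [M 3] is constantly 0, so its kernel is that of
   [res_d M 2]. *)
rewrite -[exists w, _]/(exists w, res_d M 3 w = u) -res_exactS.
by split=> /= [[->]|->].
Qed.

Definition syz_resolution : resolution (restr (kernel red_aug)) :=
  Resolution syz_aug_surj syz_exact0 syz_exactS.

Lemma syz_projective : projective_resolution syz_resolution.
Proof. by case=> [|[|j]]; [| apply: projective_prod |]; apply: projM. Qed.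

End Homotopy.
End Step.

(** Induction on [m] with [N] and [M] varying: the step passes to the kernel of [red_aug], and
    splicing [red cx (M 0)] back on delays the periodicity by one degree. *)
Lemma two_periodic_of_length m (N : lmodType S) (M : resolution (restr N)) :
  projective_resolution M ->
  (forall j, (m.+1 < j)%N -> forall v : M j, v = 0) ->
  exists M' : resolution N, projective_resolution M' /\ two_periodic_from M' m.
Proof.
elim: m N M => [|m IH] N M projM M0; have [s sE] := scale_homotopy projM.
  by apply: (short_two_periodic projM sE); apply: M0.
have [|M' [projM' perM']] := IH _ _ (@syz_projective _ _ projM _ sE).
  (* The extra summand [M 0] sits in degree 1, which never exceeds [m.+1]; this is why the induction
     stops at length 1 and not at length 0. *)
  by case=> [|[|j]] // mj; apply: (M0 j.+3).
exists (splice (red_aug_surj M) M'); split; last exact: splice_two_periodic.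
by apply: splice_projective => //; apply: projective_red.
Qed.

End Resolutions.

(* For n = 0, which forces N = 0, the bound n - 1 is read as 0. *)
Theorem theorem1 (R : pzRingType) (glR : finite_left_global_dim R)
    (x : R) (x_neq1 : 1 != x)
    (x_central : forall y : R, GRing.comm x y)
    (x_lreg : GRing.lreg x) (x_rreg : GRing.rreg x)
    (N : lmodType (ring_quot x)) (N_FP : FP_infty N)
    (n : nat) (pdN : proj_dim (restr_scalars (@ring_pi R x) N) n) :
  exists M : resolution N,
    projective_resolution M /\ two_periodic_from M n.-1.
Proof.
have [[M [projM M0]] _] := pdN.
apply: (two_periodic_of_length x_central x_lreg projM) => j nj.
(* Vanishing is needed only above [n.-1.+1], which is [n] for positive [n] and 1 for [n = 0]. *)
by apply: M0; apply: leq_trans nj; apply: leqSpred.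
Qed.
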